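(* The Ellis group of a minimal tame $G$-flow, equipped with the tau-topology, is Hausdorff.
   Context: $G$ is a topological group (possibly discrete). A $G$-flow is a compact Hausdorff space with a continuous left $G$-action $G\times X\to X$; it is minimal if every orbit is dense. Tameness: given a $G$-flow $X$, nonempty open $A_0,A_1\subseteq X$ with $\overline{A_0}\cap\overline{A_1}=\emptyset$ and $S\subseteq G$, the pair $(A_0,A_1)$ shatters $S$ if for every partition $S=S_0\sqcup S_1$ there is $x\in X$ such that for every $g\in S$ and $i<2$, $gx\in A_i$ iff $g\in S_i$. $X$ shatters $S$ if some such pair $(A_0,A_1)$ does. $X$ is tame if $X$ does not shatter any infinite $S\subseteq G$. Ellis group: for a minimal flow $X$, the enveloping semigroup is $\mathrm{E}(X)=\overline{\{(gx)_{x\in X}:g\in G\}}\subseteq X^X$, a $G$-flow all of whose minimal subflows are isomorphic; let $M_X$ be one of them. The Ellis group of $X$ is $\mathbb{G}_X=\mathrm{Aut}(M_X)$, the group of $G$-flow automorphisms of $M_X$. Its tau-topology is given by the closure operator: for $A\subseteq\mathbb{G}_X$, $p\in\mathbb{G}_X$, $p\in\mathrm{cl}_\tau(A)$ iff $\{(x,p(x)):x\in M_X\}\subseteq\overline{\bigcup_{q\in A}\{(x,q(x)):x\in M_X\}}$ in $M_X\times M_X$. *)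

(* Defs.v *)
From HB Require Import structures.
From mathcomp Require Import all_boot.
From mathcomp Require Import all_classical topology.

Set Implicit Arguments.
Unset Strict Implicit.
Unset Printing Implicit Defensive.

Local Open Scope classical_set_scope.

HB.structure Definition PreTopologicalGroup := {G of Topological G & Group G}.

HB.mixin Record PreTopologicalGroup_isTopologicalGroup G
    & PreTopologicalGroup G := {
  mulg_continuous : continuous (fun gh : G * G => (gh.1 * gh.2)%g) ;
  invg_continuous : continuous (fun g : G => (g^-1)%g)
}.

#[short(type="topologicalGroupType")]
HB.structure Definition TopologicalGroup :=
  {G of PreTopologicalGroup G & PreTopologicalGroup_isTopologicalGroup G}.

HB.mixin Record Topological_isFlow (G : topologicalGroupType) X
    & Topological X := {
  flow_act : G -> X -> X ;
  flow_act1 : forall x, flow_act 1%g x = x ;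
  flow_actM : forall g h x, flow_act (g * h)%g x = flow_act g (flow_act h x) ;
  flow_act_continuous : continuous (fun gx : G * X => flow_act gx.1 gx.2) ;
  flow_compact : compact [set: X] ;
  flow_hausdorff : hausdorff_space X
}.

#[short(type="flowType")]
HB.structure Definition Flow (G : topologicalGroupType) :=
  {X of Topological X & Topological_isFlow G X}.

Section FlowTheory.
Context {G : topologicalGroupType}.
Implicit Types X Y : flowType G.

Definition flow_orbit X (x : X) : set X := range (fun g : G => flow_act g x).

Definition minimal X := forall x : X, dense (flow_orbit x).

Definition shatters_with X (A0 A1 : set X) (S : set G) :=
  forall S0 S1 : set G, S0 `|` S1 = S -> S0 `&` S1 = set0 ->
  exists x : X, forall g, S g ->
    (A0 (flow_act g x) <-> S0 g) /\ (A1 (flow_act g x) <-> S1 g).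

Definition shatters X (S : set G) := exists A0 A1 : set X,
  [/\ open A0 /\ open A1, A0 !=set0 /\ A1 !=set0,
      closure A0 `&` closure A1 = set0 & shatters_with A0 A1 S].

Definition tame X := forall S : set G, infinite_set S -> ~ shatters X S.

(* Nonemptiness is required here because [minimal] is vacuous on the empty
   flow, which must not count as a minimal subflow. *)
Record subflow Y := Subflow {
  subflow_set :> set Y ;
  subflow_nonempty : subflow_set !=set0 ;
  subflow_closed : closed subflow_set ;
  subflow_act : forall (g : G) y, subflow_set y -> subflow_set (flow_act g y)
}.

Definition subflow_type Y (S : subflow Y) : Type := set_type (subflow_set S).

HB.instance Definition _ Y (S : subflow Y) :=
  Topological.copy (subflow_type S) (set_type (subflow_set S)).

Section SubflowIsFlow.
Variables (Y : flowType G) (S : subflow Y).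

Definition subflow_type_act (g : G) (y : subflow_type S) : subflow_type S :=
  exist _ (flow_act g (val y)) (mem_set (subflow_act g (set_mem (valP y)))).

Let act1 y : subflow_type_act 1%g y = y.
Proof. by apply: val_inj; rewrite /= flow_act1. Qed.

Let actM g h y :
  subflow_type_act (g * h)%g y = subflow_type_act g (subflow_type_act h y).
Proof. by apply: val_inj; rewrite /= flow_actM. Qed.

Lemma subflow_val_continuous : continuous (val : subflow_type S -> Y).
Proof. exact: initial_continuous. Qed.

Let act_continuous :
  continuous (fun gy : G * subflow_type S => subflow_type_act gy.1 gy.2).
Proof.
apply: continuous_comp_initial => -[g y] /=.
apply: (@cvg_comp _ _ _ (fun gy : G * subflow_type S => (gy.1, val gy.2))
  (fun gx : G * Y => flow_act gx.1 gx.2) _ (nbhs (g, val y))).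
  apply: cvg_pair; first exact: cvg_fst.
  by apply: cvg_comp; [exact: cvg_snd|exact: subflow_val_continuous].
exact: (@flow_act_continuous G Y (g, val y)).
Qed.

Let act_compact : compact [set: subflow_type S].
Proof.
have cS : compact (subflow_set S).
  exact: subclosed_compact (@subflow_closed _ S) (@flow_compact G Y) _.
move=> F PF _.
have FS : F (val @^-1` subflow_set S).
  by apply: (@filterS _ F _ setT _ _ filterT) => -[z zS] _; exact: set_mem zS.
have [y [Sy Fy]] := cS (val @ F) _ FS.
exists (exist _ y (mem_set Sy)); split=> // A B FA [_ [[C oC <-] Cy CB]].
have FvA : F (val @^-1` (val @` A)).
  by apply: (@filterS _ F _ A _ _ FA) => a Aa; exists a.
have yC : nbhs y C by move: oC; rewrite openE; exact.
by have [_ [[a Aa <-] Ca]] := Fy _ _ FvA yC; exists a; split=> //; exact: CB.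
Qed.

Let act_hausdorff : hausdorff_space (subflow_type S).
Proof.
move=> p q pq; apply: val_inj; apply: (@flow_hausdorff G Y) => A B Ap Bq.
have [z [Az Bz]] := pq (val @^-1` A) (val @^-1` B)
  (subflow_val_continuous Ap) (subflow_val_continuous Bq).
by exists (val z).
Qed.

HB.instance Definition _ := Topological_isFlow.Build G (subflow_type S)
  act1 actM act_continuous act_compact act_hausdorff.

End SubflowIsFlow.

Record minimal_subflow Y := MinimalSubflow {
  minimal_subflow_val :> subflow Y ;
  minimal_subflowP : minimal (subflow_type minimal_subflow_val)
}.

Section PowerIsFlow.
Variables (T : choiceType) (X : flowType G).

Definition ptws_act (g : G) (f : {ptws T -> X}) : {ptws T -> X} :=
  fun t => flow_act g (f t).

Let act1 f : ptws_act 1%g f = f.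
Proof. by apply: funext => t; rewrite /ptws_act flow_act1. Qed.

Let actM g h f : ptws_act (g * h)%g f = ptws_act g (ptws_act h f).
Proof. by apply: funext => t; rewrite /ptws_act flow_actM. Qed.

Lemma ptws_eval_continuous (t : T) : continuous (fun f : {ptws T -> X} => f t).
Proof. exact: (@proj_continuous T (fun=> X) t). Qed.

Lemma ptws_continuous (Z : topologicalType) (F : Z -> {ptws T -> X}) :
  (forall t, continuous (fun z => F z t)) -> continuous F.
Proof.
move=> cF z; apply/cvg_sup => t.
apply: (@continuous_comp_initial {ptws T -> X} Z X (fun f => f t) F).
exact: cF.
Qed.

Let act_continuous :
  continuous (fun gf : G * {ptws T -> X} => ptws_act gf.1 gf.2).
Proof.
apply: ptws_continuous => t [g f] /=.
apply: (@cvg_comp _ _ _ (fun gf : G * {ptws T -> X} => (gf.1, gf.2 t))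
  (fun gx : G * X => flow_act gx.1 gx.2) _ (nbhs (g, f t))).
  apply: cvg_pair; first exact: cvg_fst.
  exact: (@cvg_comp _ _ _ (fun gf : G * {ptws T -> X} => gf.2)
    (fun f : {ptws T -> X} => f t) _ _ _ cvg_snd (@ptws_eval_continuous t f)).
exact: (@flow_act_continuous G X (g, f t)).
Qed.

Let act_compact : compact [set: {ptws T -> X}].
Proof.
have := @tychonoff T (fun=> X) (fun=> [set: X]) (fun=> @flow_compact G X).
by congr compact; apply/seteqP; split.
Qed.

Let act_hausdorff : hausdorff_space {ptws T -> X}.
Proof. exact: (@hausdorff_product T (fun=> X) (fun=> @flow_hausdorff G X)). Qed.

HB.instance Definition _ := Topological_isFlow.Build G {ptws T -> X}
  act1 actM act_continuous act_compact act_hausdorff.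

End PowerIsFlow.

Lemma flow_act_continuousr Y (g : G) : continuous (fun y : Y => flow_act g y).
Proof.
move=> y.
apply: (@cvg_comp _ _ _ (fun y : Y => (g, y))
  (fun gx : G * Y => flow_act gx.1 gx.2) _ (nbhs (g, y))).
  by apply: cvg_pair; [exact: cvg_cst|exact: cvg_id].
exact: (@flow_act_continuous G Y (g, y)).
Qed.

Section EnvelopingSemigroup.
Variable X : flowType G.

Definition enveloping_set : set {ptws X -> X} :=
  closure (range (fun g : G => (fun x => flow_act g x) : {ptws X -> X})).

Let enveloping_nonempty : enveloping_set !=set0.
Proof.
by exists (fun x => flow_act 1%g x); apply: subset_closure; exists 1%g.
Qed.

Let enveloping_closed : closed enveloping_set.
Proof. exact: closed_closure. Qed.

Let enveloping_act (g : G) f :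
  enveloping_set f -> enveloping_set (flow_act g f).
Proof.
move=> Ef A /(flow_act_continuousr (g := g)) /Ef [_ [[h _ <-] Ah]].
exists (flow_act g ((fun x => flow_act h x) : {ptws X -> X})); split=> //.
exists (g * h)%g => //.
by apply: funext => x; rewrite flow_actM.
Qed.

Definition enveloping_subflow : subflow {ptws X -> X} :=
  Subflow enveloping_nonempty enveloping_closed enveloping_act.

Definition enveloping_semigroup : flowType G := subflow_type enveloping_subflow.

End EnvelopingSemigroup.

Record flow_aut Y := FlowAut {
  aut_fun :> Y -> Y ;
  aut_inv : Y -> Y ;
  aut_funK : cancel aut_fun aut_inv ;
  aut_invK : cancel aut_inv aut_fun ;
  aut_fun_continuous : continuous aut_fun ;
  aut_inv_continuous : continuous aut_inv ;
  aut_act : forall (g : G) y, aut_fun (flow_act g y) = flow_act g (aut_fun y)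
}.

HB.instance Definition _ Y := gen_eqMixin (flow_aut Y).
HB.instance Definition _ Y := gen_choiceMixin (flow_aut Y).

Section AutGroup.
Variable Y : flowType G.
Implicit Types p q : flow_aut Y.

Lemma flow_aut_eq p q : aut_fun p = aut_fun q -> p = q.
Proof.
case: p => p p' pK p'K pc p'c pa; case: q => q q' qK q'K qc q'c qa /= pq.
move: pK p'K pc pa; rewrite {}pq => pK p'K pc pa.
have p'q' : p' = q' by apply: funext => y; rewrite -[in LHS](q'K y) pK.
move: pK p'K p'c; rewrite {}p'q' => pK p'K p'c.
by congr FlowAut; exact: Prop_irrelevance.
Qed.

Let id_continuous : continuous (fun y : Y => y).
Proof. by move=> y; exact: cvg_id. Qed.

Definition aut1 : flow_aut Y :=
  @FlowAut Y (fun y => y) (fun y => y) (fun=> erefl) (fun=> erefl)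
    id_continuous id_continuous (fun _ _ => erefl).

Let inv_act p (g : G) y : aut_inv p (flow_act g y) = flow_act g (aut_inv p y).
Proof. by rewrite -{1}(aut_invK p y) -aut_act aut_funK. Qed.

Definition autV p : flow_aut Y :=
  FlowAut (@aut_invK _ p) (@aut_funK _ p) (@aut_inv_continuous _ p)
    (@aut_fun_continuous _ p) (@inv_act p).

Let comp_continuous p q : continuous (p \o q).
Proof.
by move=> y; apply: continuous_comp; exact: aut_fun_continuous.
Qed.

Let comp_inv_continuous p q : continuous (aut_inv q \o aut_inv p).
Proof.
by move=> y; apply: continuous_comp; exact: aut_inv_continuous.
Qed.

Let comp_act p q (g : G) y : (p \o q) (flow_act g y) = flow_act g ((p \o q) y).
Proof. by rewrite /= !aut_act. Qed.

Definition autM p q : flow_aut Y :=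
  FlowAut (can_comp (@aut_funK _ p) (@aut_funK _ q))
    (can_comp (@aut_invK _ q) (@aut_invK _ p))
    (@comp_continuous p q) (@comp_inv_continuous p q) (@comp_act p q).

Let autMA : associative autM.
Proof. by move=> p q r; apply: flow_aut_eq. Qed.

Let aut1M : left_id aut1 autM.
Proof. by move=> p; apply: flow_aut_eq. Qed.

Let autM1 : right_id aut1 autM.
Proof. by move=> p; apply: flow_aut_eq. Qed.

Let autVM : left_inverse aut1 autV autM.
Proof. by move=> p; apply: flow_aut_eq; apply: funext => y /=; exact: aut_funK. Qed.

Let autMV : right_inverse aut1 autV autM.
Proof. by move=> p; apply: flow_aut_eq; apply: funext => y /=; exact: aut_invK. Qed.

HB.instance Definition _ :=
  isGroup.Build (flow_aut Y) autMA aut1M autM1 autVM autMV.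

Definition aut_graph p : set (Y * Y) := range (fun y => (y, p y)).

Definition tau_closure (A : set (flow_aut Y)) : set (flow_aut Y) :=
  [set p | aut_graph p `<=` closure (\bigcup_(q in A) aut_graph q)].

Lemma subset_tau_closure A : A `<=` tau_closure A.
Proof. by move=> p Ap z pz; apply: subset_closure; exists p. Qed.

Lemma tau_closureS A B : A `<=` B -> tau_closure A `<=` tau_closure B.
Proof.
move=> AB p Ap; apply: (subset_trans Ap); apply: closureS.
by apply: bigcup_subset.
Qed.

Lemma tau_closureK A : tau_closure (tau_closure A) = tau_closure A.
Proof.
apply/seteqP; split; last exact: subset_tau_closure.
move=> p pA z /pA clz; apply: closed_closure.
by move: z clz; apply: closureS => w [q Aq /Aq].
Qed.

Lemma tau_closure0 : [set: Y] !=set0 -> tau_closure set0 = set0.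
Proof.
move=> [y _]; apply/seteqP; split=> // p /(_ (y, p y)).
by rewrite bigcup_set0 closure0; apply; exists y.
Qed.

(* On a minimal flow, the graph of an automorphism is itself a minimal flow,
   so it lies in any closed invariant set that it meets. *)
Lemma tau_closureU A B : minimal Y -> [set: Y] !=set0 ->
  tau_closure (A `|` B) = tau_closure A `|` tau_closure B.
Proof.
move=> minY [y _]; apply/seteqP; split; last first.
  by move=> p [] ; apply: tau_closureS => q; [left|right].
have key C p z : closure (\bigcup_(q in C) aut_graph q) (z, p z) ->
    tau_closure C p.
  set K := closure _ => Kz _ [w _ <-].
  have Kact (g : G) : K (flow_act g z, p (flow_act g z)).
    rewrite aut_act => V Vgz.
    have /Kz : nbhs (z, p z)
        [set u : Y * Y | V (flow_act g u.1, flow_act g u.2)].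
      have : (fun u : Y * Y => (flow_act g u.1, flow_act g u.2)) u @[u --> (z, p z)]
          --> (flow_act g z, flow_act g (p z)).
        apply: cvg_pair.
          exact: (@cvg_comp _ _ _ (fun u : Y * Y => u.1) (flow_act g) _ _ _
            cvg_fst (@flow_act_continuousr _ g z)).
        exact: (@cvg_comp _ _ _ (fun u : Y * Y => u.2) (flow_act g) _ _ _
          cvg_snd (@flow_act_continuousr _ g (p z))).
      exact.
    move=> [_ [[q Cq [v _ <-]] /= Vv]].
    exists (flow_act g v, flow_act g (q v)); split=> //.
    by exists q => //; exists (flow_act g v) => //; rewrite aut_act.
  have clK : closed [set v : Y | K (v, p v)].
    have cp : continuous (fun v : Y => (v, p v)).
      by move=> v; apply: cvg_pair; [exact: cvg_id|exact: aut_fun_continuous].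
    move/continuous_closedP: cp => /(_ K); apply; exact: closed_closure.
  apply: contrapT => nKw.
  have [||v [nKv [g _ gv]]] := minY z (~` [set v : Y | K (v, p v)]).
  - by exists w.
  - exact: closed_openC.
  by apply: nKv; rewrite /= -gv.
move=> p pAB; have : closure (\bigcup_(q in A `|` B) aut_graph q) (y, p y).
  by apply: pAB; exists y.
by rewrite bigcup_setU closureU => -[] /key; [left|right].
Qed.

End AutGroup.

(* The minimal subflows of the enveloping semigroup are all isomorphic; instead
   of choosing one, the Ellis group is indexed by it. Its product is
   composition, (p * q) y = p (q y), and its topology is the tau-topology,
   whose closure operator is [tau_closure] by [closure_tauE] below. *)
Definition ellis_group X (M : minimal_subflow (enveloping_semigroup X)) : Type :=
  flow_aut (subflow_type M).

Section EllisGroup.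
Variables (X : flowType G) (M : minimal_subflow (enveloping_semigroup X)).

HB.instance Definition _ :=
  Group.copy (ellis_group M) (flow_aut (subflow_type M)).

Definition tau_open (U : set (ellis_group M)) :=
  tau_closure (~` U) = ~` U.

Let M_nonempty : [set: subflow_type M] !=set0.
Proof.
by have [y My] := subflow_nonempty M; exists (exist _ y (mem_set My)).
Qed.

Let tau_openT : tau_open setT.
Proof. by rewrite /tau_open setCT tau_closure0. Qed.

Let tau_openI : setI_closed tau_open.
Proof.
move=> U V oU oV; rewrite /tau_open setCI.
by rewrite tau_closureU ?oU ?oV//; exact: minimal_subflowP.
Qed.

Let tau_open_bigU (I : Type) (f : I -> set (ellis_group M)) :
  (forall i, tau_open (f i)) -> tau_open (\bigcup_i f i).
Proof.
move=> fo; rewrite /tau_open setC_bigcup; apply/seteqP; split; last first.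
  exact: subset_tau_closure.
move=> p clp i _; rewrite -(fo i); apply: tau_closureS clp.
exact: bigcap_inf.
Qed.

HB.instance Definition _ := isOpenTopological.Build (ellis_group M)
  tau_openT tau_openI tau_open_bigU.

Lemma closure_tauE (A : set (ellis_group M)) : closure A = tau_closure A.
Proof.
have closedE (B : set (ellis_group M)) : closed B = (tau_closure B = B).
  by rewrite -openC -{2 3}(setCK B).
apply/seteqP; split=> [p|].
  rewrite closureEbigcap; apply; split; last exact: subset_tau_closure.
  by rewrite closedE tau_closureK.
apply: subset_trans (@tau_closureS _ _ _ (@subset_closure _ A)) _.
by have := @closed_closure _ A; rewrite closedE => ->.
Qed.

End EllisGroup.

End FlowTheory.

Arguments minimal {G} X.
Arguments tame {G} X.

(* Main.v *)
(** The sets {r | r U meets W}, for U, W open in M, are tau-open. Let phi : M -> X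
    be an evaluation and m a point of M, and suppose that V is a nonempty
    tau-open set in which {r | phi (r m) in B_0} and {r | phi (r m) in B_1} are
    both tau-dense, where B_0, B_1 are open with disjoint closures. Then a
    Cantor scheme produces an infinite independent set in G: if some r in V maps
    y into O, then by density some r' in V maps a point y' near y into O and has
    phi (r' m) in B_b. This can be done for finitely many O and both b with the
    same y', and since automorphisms commute with G, a single g that brings y'
    close to m brings all the points r' y' at once into the B_b. This contradicts
    tameness.

    Now suppose that p <> q are not separated, and choose phi, B_0, B_1 and a
    point y such that phi (p y) is in B_0 and phi (q y) is in B_1. Finitely many
    g in G are such that for each automorphism r some g has phi (p r g y) in B_0
    and phi (q r g y) in B_1; so one such g works for a dense set of r in some
    nonempty tau-open V. Then the nonempty tau-open set pV `&` qV and m := g y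
    are as above. *)
Require Import Defs.
From mathcomp Require Import all_boot.
From mathcomp Require Import all_classical topology.

Set Implicit Arguments.
Unset Strict Implicit.
Unset Printing Implicit Defensive.

Local Open Scope classical_set_scope.

(** * Topological preliminaries *)

Lemma closure_continuous (S T : topologicalType) (f : S -> T) (A : set S) x :
  continuous f -> closure A x -> closure (f @` A) (f x).
Proof.
move=> cf clA B /cf /clA [y [Ay By]].
by exists (f y); split=> //; exists y.
Qed.

Lemma open_preimage (S T : topologicalType) (f : S -> T) (A : set T) :
  continuous f -> open A -> open (f @^-1` A).
Proof. by move/continuousP; exact. Qed.

Lemma continuous_prod_map (S T S' T' : topologicalType)
    (f : S -> S') (g : T -> T') :
  continuous f -> continuous g ->
  continuous (fun u : S * T => (f u.1, g u.2)).
Proof.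
move=> cf cg u; apply: cvg_pair.
  exact: (@cvg_comp _ _ _ fst f _ _ _ cvg_fst (cf u.1)).
exact: (@cvg_comp _ _ _ snd g _ _ _ cvg_snd (cg u.2)).
Qed.

(** Finite Baire argument: either [V] lies in the closure of the head, or removing that closure
    leaves a nonempty open set covered by the tail. *)
Lemma open_subset_bigcup_seq (T : topologicalType) (I : eqType) (l : seq I)
    (E : I -> set T) (V : set T) :
  open V -> V !=set0 -> (forall x, V x -> exists2 i, i \in l & E i x) ->
  exists i W, [/\ open W, W !=set0, W `<=` V & W `<=` closure (E i)].
Proof.
elim: l V => [|i l IH] V oV [x Vx] cover; first by have [] := cover x Vx.
have [VE|/nonsubset [y [Vy nEy]]] := pselect (V `<=` closure (E i)).
  by exists i, V; split=> //; exists x.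
have oW : open (V `&` ~` closure (E i)).
  by apply: openI => //; apply: closed_openC; exact: closed_closure.
have [||j [W [oW' W0 WV WE]]] := IH _ oW; first by exists y.
  move=> z [Vz nEz]; have [j] := cover z Vz.
  rewrite inE => /orP[/eqP ->{j} Ez|jl Ez]; last by exists j.
  by case: nEz; exact: subset_closure.
by exists j, W; split=> // z /WV [].
Qed.

(** * The tau-topology on the Ellis group *)

Section EllisGroup.
Context {G : topologicalGroupType} {X : flowType G}.
Context {M : minimal_subflow (enveloping_semigroup X)}.
Local Notation Y := (subflow_type M).
Implicit Types (p q r : ellis_group M) (U W : set Y).

Definition hitting U W : set (ellis_group M) :=
  [set r | exists2 y, U y & W (r y)].

(** The complement is tau-closed: if graphs miss an open box, so does the closure of their union. *)
Lemma open_hitting U W : open U -> open W -> open (hitting U W).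
Proof.
move=> oU oW; rewrite -[hitting _ _]setCK openC => p.
rewrite closure_tauE => clp [y Uy Wpy].
have [||_ [[q nq [z _ <-]] [/= Uz Wqz]]] := clp (y, p y) _ (U `*` W).
- by exists y.
- by exists (U, W) => //; split; apply: open_nbhs_nbhs; split.
- by apply: nq; exists z.
Qed.

(** The continuous map [(id, p)] on pairs carries the graph of [r] to that of [p * r]. *)
Lemma open_ellis_mull p (V : set (ellis_group M)) :
  open V -> open [set r | V (p * r)%g].
Proof.
move=> oV; rewrite -[X in open X]setCK openC => r.
rewrite closure_tauE => clr.
suff /(open_closedC oV) : closure (~` V) (p * r)%g by [].
rewrite closure_tauE => _ [y _ <-].
have cf : continuous (fun u : Y * Y => (idfun u.1, p u.2)).
  apply: continuous_prod_map (@aut_fun_continuous _ _ p).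
  by move=> ?; exact: cvg_id.
have := closure_continuous cf (clr (y, r y) (ex_intro2 _ _ y I erefl)).
apply: closureS => _ [_ [q nq [z _ <-]] <-] /=.
by exists (p * q)%g => //; exists z.
Qed.

(** Here [(p^-1, id)] carries the graph of [r] to that of [r * p]. *)
Lemma open_ellis_mulr p (V : set (ellis_group M)) :
  open V -> open [set r | V (r * p)%g].
Proof.
move=> oV; rewrite -[X in open X]setCK openC => r.
rewrite closure_tauE => clr.
suff /(open_closedC oV) : closure (~` V) (r * p)%g by [].
rewrite closure_tauE => _ [y _ <-].
have cf : continuous (fun u : Y * Y => (aut_inv p u.1, idfun u.2)).
  apply: continuous_prod_map (@aut_inv_continuous _ _ p) _.
  by move=> ?; exact: cvg_id.
have := closure_continuous cf (clr (p y, r (p y)) (ex_intro2 _ _ (p y) I erefl)).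
rewrite /= aut_funK; apply: closureS => _ [_ [q nq [z _ <-]] <-] /=.
exists (q * p)%g => //; exists (aut_inv p z) => //=.
by rewrite aut_invK.
Qed.

(** * The Cantor scheme *)

Section Independence.
Context (phi : Y -> X) (B : bool -> set X) (m : Y) (V : set (ellis_group M)).
Hypothesis phi_continuous : continuous phi.
Hypothesis phi_act : forall g y, phi (flow_act g y) = flow_act g (phi y).
Hypothesis B_open : forall b, open (B b).
Hypothesis V_open : open V.
Hypothesis V_nonempty : V !=set0.
Hypothesis V_dense : forall b,
  V `<=` closure [set r : ellis_group M | B b (phi (r m))].

Fixpoint pattern (gs : seq G) (s : seq bool) (x : X) : Prop :=
  match gs, s with
  | g :: gs', b :: s' => B b (flow_act g x) /\ pattern gs' s' x
  | _, _ => True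
  end.

Lemma open_pattern gs s : open (pattern gs s).
Proof.
elim: gs s => [|g gs IH] [|b s] /=; try exact: openT.
apply: openI (IH s).
exact: open_preimage (@flow_act_continuousr _ _ g) (B_open b).
Qed.

(* The invariant of the Cantor scheme: a single [U] serves all patterns [s]. *)
Definition extendible (gs : seq G) := exists U : set Y, [/\ open U, U !=set0 &
  forall s, size s = size gs -> forall y, U y ->
    exists2 r, V r & pattern gs s (phi (r y))].

Lemma extendible_nil : extendible [::].
Proof.
exists setT; split; [exact: openT|by exists m|] => -[]// _ y _.
by have [r Vr] := V_nonempty; exists r.
Qed.

(** The pairs are treated one at a time: [U'] and [Z] only shrink, so the automorphisms found for
    earlier pairs still work. *)
Lemma extendible_shrink gs (U : set Y) (l : seq (seq bool * bool)) :
  open U -> U !=set0 ->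
  (forall s, size s = size gs -> forall y, U y ->
    exists2 r, V r & pattern gs s (phi (r y))) ->
  (forall sb, sb \in l -> size sb.1 = size gs) ->
  exists U' Z : set Y, [/\ [/\ open U', U' !=set0 & U' `<=` U],
    open Z, Z m & forall sb, sb \in l ->
      exists r, [/\ V r, forall y, U' y -> pattern gs sb.1 (phi (r y)) &
        forall z, Z z -> B sb.2 (phi (r z))]].
Proof.
move=> oU U0 gsU; elim: l => [_|[s b] l IH szl].
  by exists U, setT; split=> //; [split|exact: openT].
have [sb' sb'l|U' [Z [[oU' [y U'y] U'U] oZ Zm UZ]]] := IH.
  by apply: szl; rewrite inE sb'l orbT.
have phir_cont r : continuous (phi \o r).
  by move=> z; apply: continuous_comp;
    [exact: aut_fun_continuous|exact: phi_continuous].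
have [r Vr yr] := gsU s (szl (s, b) (mem_head _ _)) y (U'U y U'y).
have nr : nbhs r (V `&` hitting U' (phi @^-1` pattern gs s)).
  apply: open_nbhs_nbhs; split; last by split=> //; exists y.
  apply: openI => //; apply: open_hitting => //.
  exact: open_preimage phi_continuous (open_pattern gs s).
(* Density replaces [r] by an [r'] that also moves [m] into [B b], at the price of moving [y] to
   another point [y'] of [U']. *)
have [r' [/= Br' [Vr' [y' U'y' yr']]]] := V_dense b Vr nr.
exists (U' `&` (phi \o r') @^-1` pattern gs s).
exists (Z `&` (phi \o r') @^-1` B b); split.
- split; [|by exists y'|by move=> z [/U'U]].
  by apply: openI oU' _; exact: open_preimage (open_pattern gs s).
- by apply: openI oZ _; exact: open_preimage.
- by [].
- move=> sb; rewrite inE => /orP[/eqP ->|/UZ [t [Vt tU tZ]]].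
    by exists r'; split=> // z [].
  by exists t; split=> // z [? _]; [exact: tU|exact: tZ].
Qed.

Lemma extendible_cons gs : extendible gs -> exists g, extendible (g :: gs).
Proof.
move=> [U [oU U0 gsU]].
(* All patterns, each with both values of the next bit. *)
pose l := [seq (val t.1, t.2) | t : (size gs).-tuple bool * bool].
have szl sb : sb \in l -> size sb.1 = size gs.
  by move=> /mapP[t _ ->]; exact: size_tuple.
have [U' [Z [[oU' [y U'y] _] oZ Zm UZ]]] := extendible_shrink oU U0 gsU szl.
have [||_ [/[swap] -[g _ <-] Zgy]] := @minimal_subflowP _ _ M y Z => //.
  by exists m.
exists g, (U' `&` flow_act g @^-1` Z); split.
- by apply: openI oU' _; exact: open_preimage (@flow_act_continuousr _ _ g) _.
- by exists y.
move=> [//|b s] [szs] z [U'z Zgz].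
have [|r [Vr rU rZ]] := UZ (s, b).
  by apply/mapP; exists (Tuple (introT eqP szs), b); rewrite ?mem_enum.
by exists r => //=; split; [rewrite -phi_act -aut_act; exact: rZ|exact: rU].
Qed.

Lemma exists_independent_sequence : exists g : nat -> G,
  forall (e : nat -> bool) n, exists x, forall i, (i < n)%N ->
    B (e i) (flow_act (g i) x).
Proof.
have /choice [h hP] : forall gs, exists g, extendible gs -> extendible (g :: gs).
  move=> gs; have [/extendible_cons [g]|] := pselect (extendible gs).
    by exists g.
  (* A dummy value: every [L n] below is extendible. *)
  by exists 1%g.
pose L n := iter n (fun gs => h gs :: gs) [::].
have LP n : extendible (L n).
  by elim: n => [|n IH]; [exact: extendible_nil|exact: hP].
have szL n : size (L n) = n by elim: n => //= n ->.
exists (fun n => h (L n)) => e n.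
(* [L n] has its latest element first, so the bits of [e] are listed in reverse order too. *)
pose s k := iteri k (fun j s => e j :: s) [::].
have szs k : size (s k) = k by elim: k => //= k ->.
have [U [_ [y Uy]]] := LP n => /(_ (s n)).
rewrite szL szs => /(_ erefl y Uy) [r _].
move: (phi (r y)) => x pat; exists x; elim: n pat {U y Uy r} => //= n IH [Bn pat] i.
by rewrite ltnS leq_eqVlt => /predU1P[->//|]; exact: IH.
Qed.

End Independence.
End EllisGroup.

(** * Compactness and tameness *)

Lemma minimal_finite_cover (G : topologicalGroupType) (Y : flowType G)
    (W : set Y) :
  minimal Y -> open W -> W !=set0 ->
  exists l : seq G, forall y, exists2 g, g \in l & W (flow_act g y).
Proof.
move=> minY oW W0.
(* Along the filter of ever larger lists, near-covering compactness merges the local choices of one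
   [g] into a single list. *)
pose F := filter_from setT (fun l0 : seq G => [set l : seq G | {subset l0 <= l}]).
have FF : Filter F.
  apply: filter_from_filter; first by exists [::].
  move=> l1 l2 _ _; exists (l1 ++ l2) => // l sub.
  by split=> g gl; apply: sub; rewrite mem_cat gl ?orbT.
have /compact_near_coveringP cY := @flow_compact G Y.
have [|l _ lP] := cY _ F
  (fun l y => exists2 g, g \in l & W (flow_act g y)) FF; last first.
  by exists l => y; exact: (lP l).
move=> y _; have [||_ [/[swap] -[g _ <-] Wgy]] := minY y W => //.
exists (flow_act g @^-1` W, [set l | g \in l]).
  split=> /=.
    apply: open_nbhs_nbhs; split=> //.
    exact: open_preimage (@flow_act_continuousr _ _ g) oW.
  by exists [:: g] => // l sub; apply: sub; rewrite mem_head.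
by move=> [z l] /= [Wz gl]; exists g.
Qed.

Lemma compact_hausdorff_shrink (X : topologicalType) (x : X) (U : set X) :
  compact [set: X] -> hausdorff_space X -> nbhs x U ->
  exists W : set X, [/\ open W, W x & closure W `<=` U].
Proof.
move=> cX hX Ux.
have [W Wx WU] := compact_regular hX cX (@filterT _ (nbhs x) _) Ux.
exists W^°; split; [exact: open_interior|exact: Wx|].
exact: subset_trans (closureS (@interior_subset _ W)) WU.
Qed.

(** Two layers: finite approximations live in the [B b], and their limits, lying in [closure (B b)],
    in the open [A b] used for shattering. *)
Lemma compact_hausdorff_separation (X : topologicalType) (x0 x1 : X) :
  compact [set: X] -> hausdorff_space X -> x0 <> x1 ->
  exists A B : bool -> set X, [/\ forall b, open (A b) /\ open (B b),
    forall b, closure (B b) `<=` A b, B true x0, B false x1 &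
    closure (A true) `&` closure (A false) = set0].
Proof.
move=> cX hX /eqP x01; have := hX; rewrite open_hausdorff => /(_ _ _ x01).
move=> [[U0 U1] /= []]; rewrite !inE => U0x U1x [oU0 oU1 U01].
have shrink x U oU Ux :=
  @compact_hausdorff_shrink X x U cX hX (open_nbhs_nbhs (conj oU Ux)).
have [A0 [oA0 A0x A0U]] := shrink _ _ oU0 U0x.
have [A1 [oA1 A1x A1U]] := shrink _ _ oU1 U1x.
have [B0 [oB0 B0x B0A]] := shrink _ _ oA0 A0x.
have [B1 [oB1 B1x B1A]] := shrink _ _ oA1 A1x.
exists (fun b => if b then A0 else A1), (fun b => if b then B0 else B1).
split=> //; [by case|by case|].
apply/seteqP; split=> // z [/A0U ? /A1U ?].
by have : (U0 `&` U1) z by []; rewrite U01.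
Qed.

Lemma tame_not_independent (G : topologicalGroupType) (X : flowType G)
    (A B : bool -> set X) (g : nat -> G) :
  tame X -> (forall b, open (A b)) -> (forall b, closure (B b) `<=` A b) ->
  closure (A true) `&` closure (A false) = set0 ->
  ~ (forall (e : nat -> bool) n, exists x, forall i, (i < n)%N ->
      B (e i) (flow_act (g i) x)).
Proof.
move=> tX oA BA A01 indep.
(* A cluster point of the finite witnesses [u n] meets all conditions at once. *)
have indepA e : exists x, forall i, A (e i) (flow_act (g i) x).
  have /choice [u uB] := indep e.
  have [x [_ ux]] := @flow_compact G X (u @ \oo) _ filterT.
  exists x => i; apply: BA => W /(@flow_act_continuousr G X (g i)) Wx.
  have [|z [Bz Wz]] := ux [set z | B (e i) (flow_act (g i) z)] _ _ Wx.
    by exists i.+1 => // n /= /(uB n i).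
  by exists (flow_act (g i) z).
have AF x : A true x -> A false x -> False.
  move=> /subset_closure A1 /subset_closure A0.
  by have : set0 x by rewrite -A01.
have g_inj : injective g.
  (* This [e] is true at [i] only, so [g i = g j] with [i <> j] would put one point in both [A true]
     and [A false]. *)
  move=> i j gij; have [x Ax] := indepA (eq_op ^~ i).
  have := Ax j; have := Ax i; rewrite eqxx gij; case: eqVneq => // _.
  by move=> /AF /[apply].
apply: (tX (range g)).
  move=> /(finite_preimage (f := g)) fin; apply: infinite_nat.
  by apply: sub_finite_set (fin _) => [n _|n k _ _ /g_inj//]; exists n.
exists (A true), (A false); split=> //.
- split.
    by have [x /(_ 0%N) Ax] := indepA xpredT; exists (flow_act (g 0%N) x).
  by have [x /(_ 0%N) Ax] := indepA xpred0; exists (flow_act (g 0%N) x).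
move=> S0 S1 S01 S01_0; have [x Ax] := indepA (fun n => `[< S0 (g n) >]).
exists x => _ [n _ <-]; move/(_ n): Ax.
have [S0g|nS0g] := asboolP (S0 (g n)) => Ax.
  split; first by split.
  split=> [/(AF _ Ax)//|S1g].
  by have : set0 (g n) by rewrite -S01_0.
split; first by split=> [/AF /(_ Ax)|/nS0g].
split=> // _.
by have : (S0 `|` S1) (g n); [rewrite S01; exists n|case].
Qed.

Theorem theorem11p7 (G : topologicalGroupType) (X : flowType G)
    (X_minimal : minimal X) (X_tame : tame X)
    (M : minimal_subflow (enveloping_semigroup X)) :
  hausdorff_space (ellis_group M).
Proof.
move=> p q pq; apply: flow_aut_eq; apply: funext => y.
(* Points of M are functions on X under two subtype layers, so distinct ones differ at some [x]. *)
do 2 apply: val_inj; apply: funext => x; apply: contrapT.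
pose phi (z : subflow_type M) : X := (val (val z) : {ptws X -> X}) x.
have phi_continuous : continuous phi.
  move=> z; apply: (@continuous_comp (subflow_type M) {ptws X -> X} X
    (fun z => val (val z)) (fun f => f x)); last exact: ptws_eval_continuous.
  by apply: (@continuous_comp _ (enveloping_semigroup X));
    exact: subflow_val_continuous.
have phi_act g z : phi (flow_act g z) = flow_act g (phi z) by [].
have phir_continuous (r : ellis_group M) : continuous (phi \o r).
  by move=> z; apply: continuous_comp;
    [exact: aut_fun_continuous|exact: phi_continuous].
rewrite -/(phi (p y)) -/(phi (q y)).
move=> /(compact_hausdorff_separation (@flow_compact _ X) (@flow_hausdorff _ X)).
move=> [A [B [oAB BA Bp Bq A01]]].
pose W := (phi \o p) @^-1` B true `&` (phi \o q) @^-1` B false.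
have oW : open W.
  by apply: openI; apply: open_preimage => //; exact: (oAB _).2.
have [|l lW] := minimal_finite_cover (@minimal_subflowP _ _ M) oW.
  by exists y.
(* Each point [r y] is moved into [W] by some [g] in [l], so these finitely many sets cover the
   group. *)
have [|g [V [oV [r0 Vr0] _ VE]]] := @open_subset_bigcup_seq (ellis_group M) _ l
    (fun g => [set r | W (flow_act g (r y))]) setT openT (ex_intro _ 1%g I).
  by move=> r _; exact: lW.
(* [p r0] and [q r0] are not separated either, so [p V] and [q V] meet. *)
pose V' : set (ellis_group M) :=
  [set s | V (p^-1 * s)%g] `&` [set s | V (q^-1 * s)%g].
have oV' : open V' by apply: openI; exact: open_ellis_mull.
have V'0 : V' !=set0.
  have npV : nbhs p [set s | V (p^-1 * (s * r0))%g].
    apply: open_nbhs_nbhs; split; last by rewrite /= mulKg.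
    exact: open_ellis_mulr (open_ellis_mull _ oV).
  have nqV : nbhs q [set s | V (q^-1 * (s * r0))%g].
    apply: open_nbhs_nbhs; split; last by rewrite /= mulKg.
    exact: open_ellis_mulr (open_ellis_mull _ oV).
  by have [s [? ?]] := pq _ _ npV nqV; exists (s * r0)%g.
have V'_dense b :
    V' `<=` closure [set s : ellis_group M | B b (phi (s (flow_act g y)))].
  move=> s V's N; rewrite nbhsE => -[O [oO Os] ON].
  (* Approximate [t^-1 * s], which is in [V], by an [r] with [g (r y)] in [W]; then [t * r] is close
     to [s] and the [t]-half of [W] gives [B b]. *)
  pose t := if b then p else q.
  have nt : nbhs (t^-1 * s)%g [set r | O (t * r)%g].
    apply: open_nbhs_nbhs; split; last by rewrite /= mulVKg.
    exact: open_ellis_mull.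
  have Vts : V (t^-1 * s)%g by rewrite /t; case: b t nt => _ _; case: V's.
  have [r [Wr Or]] := VE _ Vts _ nt.
  exists (t * r)%g; split; last exact: ON.
  rewrite /= (aut_act r) /t; case: b t nt Vts Or => _ _ _ _; case: Wr => //.
have oB b : open (B b) by exact: (oAB b).2.
have oA b : open (A b) by exact: (oAB b).1.
have [h] := exists_independent_sequence phi_continuous phi_act oB oV' V'0 V'_dense.
exact: tame_not_independent X_tame oA BA A01.
Qed.
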